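(* There is a function $\varepsilon:\mathbb{N}\to\mathbb{R}$ with $\varepsilon(n)\to 0$ as $n\to\infty$ such that every connected graph $G$ on $n$ vertices satisfies $c(G)\le n\,2^{-(1+\varepsilon(n))\sqrt{\log n}}$. In other words, the cop number of any connected $n$-vertex graph is at most $n\,2^{-(1+o(1))\sqrt{\log n}}$.
   Context: All logarithms are base $2$. Graphs are finite, simple and undirected. The game of Cops and Robbers on a graph $G$ is played as follows: a set of $k\ge 1$ cops first occupy some $k$ vertices of $G$ (several cops may share a vertex), then the robber chooses a vertex. Afterwards they move alternately, first all cops, then the robber; in a move each cop (resp. the robber) either moves to an adjacent vertex or stays put. The cops win if at some time some cop is on the same vertex as the robber; otherwise the robber wins. Both sides see all positions. The cop number $c(G)$ is the minimum $k$ for which the cops have a strategy that wins no matter how the robber plays. *)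

(* Defs.v *)
From mathcomp Require Import all_boot all_order all_algebra.
From mathcomp Require Import boolp classical_sets reals topology normedtype sequences exp.

Set Implicit Arguments.
Unset Strict Implicit.
Unset Printing Implicit Defensive.

Import Order.TTheory GRing.Theory Num.Theory.

Section Graphs.
Variables (T : finType) (e : rel T).

Definition simple_graph : Prop := symmetric e /\ irreflexive e.

Definition connected_graph : Prop :=
  (0 < #|T|)%N /\ forall x y : T, connect e x y.

(* One player's move: stay put or cross an edge. *)
Definition step (x y : T) : bool := (x == y) || e x y.

Definition robber_play (r : nat -> T) : Prop := forall t, step (r t) (r t.+1).

(* Past cop positions are determined by the strategy and the robber's past
   positions, so a deterministic strategy only needs the latter as argument:
   [s [::]] is the initial placement of the cops and
   [s [:: r 0; ...; r t]] is their placement after they have answered [r t]. *)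
Definition cop_strategy (k : nat) := seq T -> 'I_k -> T.

Definition legal_strategy k (s : cop_strategy k) : Prop :=
  forall r, robber_play r ->
  forall t i, step (s (mkseq r t) i) (s (mkseq r t.+1) i).

(* The robber at [r t] meets a cop either on arriving there (the cops being at
   [s (mkseq r t)]) or through the cops' next move. *)
Definition winning_strategy k (s : cop_strategy k) : Prop :=
  forall r, robber_play r ->
  exists t, exists i, s (mkseq r t) i = r t \/ s (mkseq r t.+1) i = r t.

Definition cops_win (k : nat) : Prop :=
  exists s : cop_strategy k, legal_strategy s /\ winning_strategy s.

(* The default value 0 is only taken on the graph without vertices; see
   [cop_numberP]. *)
Definition cop_number : nat :=
  if pselect (exists k, (0 < k)%N && `[< cops_win k >]) is left h
  then ex_minn h else 0%N.

Lemma cop_numberP : (0 < #|T|)%N ->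
  [/\ (0 < cop_number)%N, cops_win cop_number &
      forall k, (0 < k)%N -> cops_win k -> (cop_number <= k)%N].
Proof.
move=> T0; rewrite /cop_number; case: pselect => [h|[]].
  case: ex_minnP => m /andP[m0 /asboolP wm] mmin; split=> // k k0 wk.
  by apply: mmin; rewrite k0; apply/asboolP.
exists #|T|; rewrite T0; apply/asboolP.
exists (fun _ i => enum_val i); split=> [r _ t i|r _]; first by rewrite /step eqxx.
by exists 0%N, (enum_rank (r 0%N)); left; rewrite enum_rankK.
Qed.

End Graphs.

Definition log2 (R : realType) (x : R) : R := (ln x / ln 2)%R.

(* Main.v *)
Require Import Defs.
From mathcomp Require Import all_boot all_order all_algebra.
From mathcomp Require Import boolp reals sequences exp.
From mathcomp Require Import ring lra.
Import Order.TTheory GRing.Theory Num.Theory.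

Set Implicit Arguments.
Unset Strict Implicit.
Unset Printing Implicit Defensive.

(** The argument of Scott and Sudakov. Let [2 ^ (s * s) <= n < 2 ^ (s.+1 * s.+1)]
    and [q = 2 ^ s].

    While the subgraph available to the robber contains a geodesic with about
    [q / 4] vertices, one cop can guard that path for ever, and its vertices can
    be deleted; this costs at most about [4 n / q] cops. Afterwards every
    component has diameter at most [2 ^ t] with [t = s - 2].

    For each [i <= t] place [O(n s ^ 2 / q)] cops at random. With positive
    probability, every set [Y] whose ball of radius [2 ^ i] has at least [q #|Y|]
    vertices has at least [#|Y|] of these cops in that ball. Suppose the robber is
    known to be in [A] after [2 ^ i - 1] moves, and let [X] be a largest subset of
    [A] whose ball of radius [2 ^ i] has at most [q #|X|] vertices. By Hall's
    theorem the [i]-th team can occupy [A :\: X] with its [2 ^ i]-th move, so the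
    robber is in [X], and after [2 ^ i] further moves he is in a set of at most
    [q #|A|] vertices. Starting from one vertex, at [i = t] the ball of a nonempty
    [X] would be a whole component of at most [q ^ t.+1 <= n / q] vertices, and
    such a small component can be filled with cops from the start. *)

(** * The pursuit game, redeployment of cops, and guarding a geodesic *)

Section Game.
Variables (T : finType) (e : rel T).
Local Notation step := (step e).

Lemma step_refl x : step x x.
Proof. by rewrite /Defs.step eqxx. Qed.

(** A position with the cops to move, against a robber who never leaves [U]; the cops may use the
    whole graph. Being inductive, it makes every play end after finitely many rounds. *)
Inductive catch (I : Type) (U : {set T}) : (I -> T) -> T -> Prop :=
| catch_now c r i : step (c i) r -> catch U c r
| catch_move c c' r : (forall i, step (c i) (c' i)) ->
    (forall r', r' \in U -> step r r' -> catch U c' r') -> catch U c r.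

Arguments catch_now [I U c r] i _.
Arguments catch_move [I U c] c' [r] _ _.

(** All large enough teams and all placements are allowed, so a team can be given a new task in the
    middle of the game, wherever it then stands. *)
Definition catchable k (U : {set T}) : Prop :=
  forall (I : finType) (c : I -> T) r, k <= #|I| -> r \in U -> catch U c r.

Definition winning_from k (c : 'I_k -> T) (r0 : T) (s : cop_strategy T k) :=
  s [::] = c /\ forall r, robber_play e r -> r 0 = r0 ->
    (forall t i, step (s (mkseq r t) i) (s (mkseq r t.+1) i)) /\
    (exists t, exists i, s (mkseq r t) i = r t \/ s (mkseq r t.+1) i = r t).

Lemma mkseqS (r : nat -> T) t :
  mkseq r t.+1 = r 0 :: mkseq (fun u => r u.+1) t.
Proof. by rewrite /mkseq /= -[1]addn0 iotaDl -map_comp. Qed.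

(** Induction on the derivation: a strategy is chosen for each reply of the robber, and the history
    tells which one to follow. *)
Lemma catch_strategy k (c : 'I_k -> T) r0 :
  catch [set: T] c r0 -> exists s, winning_from c r0 s.
Proof.
elim=> {c r0} [c r0 i cr0|c c' r0 cc' _ IH].
  (* After the capture everyone stays put, since legality is required at all times. *)
  exists (fun h j => if h is [::] then c j else if j == i then r0 else c j).
  split=> // r _ r00; split.
    by case=> [|t] j; rewrite !mkseqS ?step_refl //; case: eqP => [->|_] //;
       rewrite step_refl.
  by exists 0, i; right; rewrite /= eqxx.
have {}IH r' : exists s, step r0 r' -> winning_from c' r' s.
  have [/(IH r' (in_setT _))[s sP]|nst] := boolP (step r0 r').
    by exists s.
  by exists (fun _ => c').
have [S SP] := choice IH.
(* [S r'] starts from [c'], so running it on the history without its first entry continues the first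
   move legally. *)
pose s := fun h : seq T =>
  match h with
  | [::] => c
  | _ :: [::] => c'
  | _ :: ((r' :: _) as h') => S r' h'
  end.
exists s; split=> // r rP r00.
pose r1 u := r u.+1.
have [|S0 /(_ r1)[||Sleg [t [i St]]]] // := SP (r 1).
- by rewrite -r00; apply: rP.
- by move=> u; apply: rP.
have sE u : s (mkseq r u.+1) = S (r 1) (mkseq r1 u).
  by rewrite mkseqS; case: u => [|u]; rewrite ?S0 // mkseqS.
split=> [[|u] j|]; first exact: cc'.
  by rewrite !sE; apply: Sleg.
by exists t.+1, i; rewrite !sE.
Qed.

Lemma catchable_cops_win k : 0 < #|T| -> catchable k [set: T] -> cops_win e k.
Proof.
case/card_gt0P=> x0 _ kT.
pose c0 (_ : 'I_k) := x0.
have /choice[S SP] r0 : exists s, winning_from c0 r0 s.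
  by apply: catch_strategy; apply: kT; rewrite ?card_ord ?in_setT.
exists (fun h => if h is r0 :: _ then S r0 h else c0); split.
  move=> r rP t i; have [S0 /(_ r rP erefl)[Sleg _]] := SP (r 0).
  by case: t => [|t]; [move: (Sleg 0 i)|move: (Sleg t.+1 i)]; rewrite !mkseqS //= S0.
move=> r rP; have [S0 /(_ r rP erefl)[_ [t [i St]]]] := SP (r 0).
exists t, i; case: t St => [|t]; rewrite ?mkseqS //=.
by rewrite S0.
Qed.

(** Moves inside [U] cannot leave [W], so the same cop moves work. This lets one component of [U] be
    treated alone. *)
Lemma catch_sub (I : Type) (U W : {set T}) (c : I -> T) r :
  (forall x y, x \in W -> y \in U -> step x y -> y \in W) ->
  catch W c r -> r \in W -> catch U c r.
Proof.
move=> WU; elim=> {c r} [c r i cr _|c c' r cc' _ IH rW].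
  exact: catch_now cr.
by apply: (catch_move c') => // r' r'U rr'; have r'W := WU _ _ rW r'U rr'; apply: IH.
Qed.

Lemma catch_inj (I J : finType) (U : {set T}) (h : I -> J) (d : I -> T) r :
  injective h -> catch U d r ->
  forall c : J -> T, (forall i, c (h i) = d i) -> catch U c r.
Proof.
move=> hI; elim=> {d r} [d r i dr|d d' r dd' _ IH] c cd.
  by apply: (catch_now (h i)); rewrite cd.
pose c' j := if [pick i | h i == j] is Some i then d' i else c j.
apply: (catch_move c') => [j|r' r'U rr'].
  rewrite /c'; case: pickP => [i /eqP <-|_]; last exact: step_refl.
  by rewrite cd.
apply: IH => // i; rewrite /c'; case: pickP => [i' /eqP/hI-> //|/(_ i)].
by rewrite eqxx.
Qed.

Lemma catchableP (I : finType) k (U : {set T}) : #|I| <= k ->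
  (forall (c : I -> T) r, r \in U -> catch U c r) -> catchable k U.
Proof.
move=> Ik IU J c r kJ rU.
pose h (i : I) : J := enum_val (widen_ord (leq_trans Ik kJ) (enum_rank i)).
have hI : injective h.
  move=> i j /enum_val_inj /(congr1 val) /= /val_inj; exact: enum_rank_inj.
by apply: (catch_inj hI (IU (fun i => c (h i)) r rU)).
Qed.

Lemma catchable_leq k l (U : {set T}) : k <= l -> catchable k U -> catchable l U.
Proof. by move=> kl kU I c r lI; apply: kU; apply: leq_trans lI. Qed.

(* [R s] bounds the uncaught robber's position after [s] rounds. *)
Lemma catch_along (I : Type) (U : {set T}) (g : I -> nat -> T)
    (R : nat -> {set T}) N :
  (forall i s, step (g i s) (g i s.+1)) ->
  (forall s x y, s < N -> x \in R s -> y \in U -> step x y ->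
     (exists i, g i s.+1 = x) \/ y \in R s.+1) ->
  (forall x, x \in R N -> catch U (g^~ N) x) ->
  forall r, r \in R 0 -> catch U (g^~ 0) r.
Proof.
move=> gS RS RN r r0.
suff H d : forall s x, s + d = N -> x \in R s -> catch U (g^~ s) x.
  exact: (H N).
elim: d => [|d IH] s x; first by rewrite addn0 => ->; apply: RN.
rewrite addnS -addSn => sN xs.
have [[i ix]|nx] := pselect (exists i, g i s.+1 = x).
  by apply: (catch_now i); rewrite -ix.
apply: (catch_move (g^~ s.+1)) => // y yU xy.
apply: IH => //; case: (RS s x y) => //.
by rewrite -sN leq_addr.
Qed.

(** The walk waits at [y] from time [N] on, so walks of different lengths can be run in parallel up
    to a common time. *)
Definition walkto N x y : Prop := exists w : nat -> T,
  [/\ w 0 = x, forall s, step (w s) (w s.+1) & forall s, N <= s -> w s = y].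

Lemma walkto_refl N x : walkto N x x.
Proof. by exists (fun _ => x); split=> // s; apply: step_refl. Qed.

Lemma walkto_cons N x y z : step x y -> walkto N y z -> walkto N.+1 x z.
Proof.
move=> xy [w [w0 wS wN]].
exists (fun s => if s is s'.+1 then w s' else x); split=> //.
  by case=> [|s] //; rewrite w0.
by case.
Qed.

Lemma walkto_leq M N x y : M <= N -> walkto M x y -> walkto N x y.
Proof.
move=> MN [w [w0 wS wN]]; exists w; split=> // s Ns.
by apply: wN; apply: leq_trans Ns.
Qed.

Lemma connect_walkto x y : connect e x y -> exists N, walkto N x y.
Proof.
case/connectP=> p; elim: p x => [|z p IH] x /= => [_ ->|/andP[xz zp] yE].
  by exists 0; apply: walkto_refl.
have [N zN] := IH z zp yE; exists N.+1; apply: walkto_cons zN.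
by rewrite /Defs.step xz orbT.
Qed.

Hypothesis e_conn : forall x y : T, connect e x y.

(** The cops regroup along walks of the connected graph; meanwhile the robber can only change his
    place in [U], and [c'] wins against each of these. *)
Lemma catch_goto (I : finType) (U : {set T}) (c c' : I -> T) :
  (forall r, r \in U -> catch U c' r) -> forall r, r \in U -> catch U c r.
Proof.
move=> c'P.
have /choice[N NP] i : exists N, walkto N (c i) (c' i) by apply: connect_walkto.
pose M := \max_i N i.
have /choice[g gP] i : walkto M (c i) (c' i).
  by apply: walkto_leq (NP i); apply: leq_bigmax.
have -> : c = g^~ 0 by apply/funext => i; case: (gP i).
apply: (catch_along (R := fun _ => U) (N := M)) => [i s|s x y *|x xU].
- by case: (gP i).
- by right.
suff -> : g^~ M = c' by apply: c'P.
by apply/funext => i; case: (gP i) => _ _; apply.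
Qed.

Hypothesis e_sym : symmetric e.

Lemma step_sym x y : step x y = step y x.
Proof. by rewrite /Defs.step eq_sym e_sym. Qed.

(* The extra cop shadows the image of the robber under the retraction
   [p \o d] of [U] onto the path [p 0, ..., p D]. *)
Lemma path_guard k (U : {set T}) D (p : nat -> T) (d : T -> nat) :
  (forall i, i < D -> step (p i) (p i.+1)) ->
  (forall i, i <= D -> d (p i) = i) ->
  (forall x, x \in U -> d x <= D) ->
  (forall x y, x \in U -> y \in U -> step x y -> d y <= (d x).+1) ->
  catchable k (U :\: [set p i | i : 'I_D.+1]) -> catchable k.+1 U.
Proof.
set P := [set _ | _ : _] => pS dp dD dS kU.
(* By symmetry [d] changes by at most one per move, so the image of the robber on the path moves
   like a legal cop. *)
have dlip x y : x \in U -> y \in U -> step x y -> step (p (d x)) (p (d y)).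
  move=> xU yU xy; have := dS x y xU yU xy; have := dS y x yU xU.
  rewrite step_sym => /(_ xy).
  case: (ltngtP (d x) (d y)) => [lt _|lt + _|-> *]; last exact: step_refl.
    move=> le; have -> : d y = (d x).+1 by apply/eqP; rewrite eqn_leq le.
    by apply: pS; apply: leq_trans lt (dD y yU).
  move=> le; have -> : d x = (d y).+1 by apply/eqP; rewrite eqn_leq le.
  by rewrite step_sym; apply: pS; apply: leq_trans lt (dD x xU).
have dP x : x \in P -> p (d x) = x.
  by case/imsetP=> i _ ->; rewrite dp // -ltnS ltn_ord.
(* Once within one step of the image, the extra cop stays so. On the path the robber equals his
   image and is caught, so the other cops face a robber confined to [U :\: P]. *)
have sync (c : option 'I_k -> T) r : r \in U -> step (c None) (p (d r)) ->
    catch U c r.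
  move=> rU cr; have [rP|rP] := boolP (r \in P).
    by apply: (catch_now None); rewrite -[r in step _ r]dP.
  have: catch (U :\: P) (fun i => c (Some i)) r.
    by apply: kU; rewrite ?card_ord // !inE rP.
  move E: (fun i => c (Some i)) => c1 c1r.
  elim: c1r c E rU cr {rP} => {c1 r} [c1 r i c1r|c1 c1' r c11 _ IH] c cE rU cr.
    by apply: (catch_now (Some i)); rewrite -cE in c1r.
  apply: (catch_move (fun j => if j is Some i then c1' i else p (d r))).
    by case=> [i|//]; move: (c11 i); rewrite -cE.
  move=> r' r'U rr'; have rr'd := dlip _ _ rU r'U rr'.
  have [r'P|r'P] := boolP (r' \in P).
    by apply: (catch_now None); rewrite -[r' in step _ r']dP.
  by apply: IH => //; rewrite !inE r'P.
apply: (@catchableP (option 'I_k)); first by rewrite card_option card_ord.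
move=> c; pose c0 j := if j is None then p 0 else c j.
have c0N : c0 None = p 0 by [].
apply: (@catch_goto _ U c c0); move: c0 c0N => {}c c0 r rU.
(* The extra cop climbs the path from [p 0], staying at or below the image; [D - j] decreases until
   [sync] applies. *)
have {c0} [j cj jr] : exists2 j, c None = p j & j <= d r by exists 0.
move: {2}(D - j) (erefl (D - j)) => b.
elim: b j c r rU cj jr => [|b IH] j c r rU cj jr Db.
  apply: sync => //; suff <- : j = d r by rewrite cj step_refl.
  apply/eqP; rewrite eqn_leq jr (leq_trans (dD r rU)) //.
  by rewrite -subn_eq0 Db.
move: jr; rewrite leq_eqVlt => /predU1P[jr|jr].
  by apply: sync => //; rewrite cj jr step_refl.
have jD : j < D by apply: leq_trans jr (dD r rU).
apply: (catch_move (fun i => if i is None then p j.+1 else c i)).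
  by case=> [i|]; rewrite ?step_refl // cj pS.
move=> r' r'U rr'; have := dS r' r r'U rU; rewrite step_sym => /(_ rr') le.
have [lt|ge] := ltnP j (d r').
  by apply: (IH j.+1) => //; rewrite subnS Db.
apply: sync => //.
(* The image was above [j] and dropped by at most one, so it is now at [p j], next to the cop on
   [p j.+1]. *)
have <- : j = d r' by apply/eqP; rewrite eqn_leq ge -ltnS (leq_trans jr le).
by rewrite step_sym pS.
Qed.

End Game.

Arguments catch_now [T e I U c r] i _.
Arguments catch_move [T e I U c] c' [r] _ _.

(** * Hall's marriage theorem *)

Section Hall.
Variables (I J : finType) (E : I -> J -> bool) (j0 : J).

Definition nbh (R : {set J}) (Y : {set I}) :=
  [set j in R | [exists x in Y, E x j]].

(** Induction on [#|S|]. A tight proper nonempty subset [Y] splits the problem into [Y] and its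
    complement; if there is none, one element is matched arbitrarily. *)
Theorem hall (S : {set I}) (R : {set J}) :
  (forall Y : {set I}, Y \subset S -> #|Y| <= #|nbh R Y|) ->
  exists h : I -> J, {in S &, injective h} /\
    forall x, x \in S -> h x \in R /\ E x (h x).
Proof.
elim/ltn_ind: {S}#|S| {-2}S (erefl #|S|) R => N IH S SN R hallS.
have glue (A : {set I}) (B : {set J}) (h1 h2 : I -> J) : A \subset S -> B \subset R ->
    {in A &, injective h1} -> (forall x, x \in A -> h1 x \in B /\ E x (h1 x)) ->
    {in S :\: A &, injective h2} ->
    (forall x, x \in S :\: A -> h2 x \in R :\: B /\ E x (h2 x)) ->
    exists h : I -> J, {in S &, injective h} /\
      forall x, x \in S -> h x \in R /\ E x (h x).
  move=> AS BR inj1 P1 inj2 P2; exists (fun x => if x \in A then h1 x else h2 x).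
  split=> [x y xS yS|x xS].
    have xD : x \notin A -> x \in S :\: A by rewrite inE xS andbT.
    have yD : y \notin A -> y \in S :\: A by rewrite inE yS andbT.
    case: ifPn => xA; case: ifPn => yA; first exact: inj1.
    - have [xB _] := P1 x xA; have [+ _] := P2 y (yD yA) => + E1.
      by rewrite -E1 inE xB.
    - have [yB _] := P1 y yA; have [+ _] := P2 x (xD xA) => + E1.
      by rewrite E1 inE yB.
    - by apply: inj2; [apply: xD|apply: yD].
  case: ifPn => xA; first by have [/(subsetP BR)] := P1 x xA.
  by have [|/setDP[]] := P2 x; rewrite // inE xA.
have [S0|[x xS]] := set_0Vmem S.
  by exists (fun _ => j0); split=> x; rewrite S0 inE.
have [/existsP[Y /and4P[YS Y0 YneS /eqP YR]]|noY] := boolP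
  [exists Y : {set I}, [&& Y \subset S, Y != set0, Y != S & #|nbh R Y| == #|Y|]].
  have YltS : #|Y| < N by rewrite -SN proper_card // properEneq YneS.
  have [|h1 [inj1 P1]] := IH _ YltS Y erefl (nbh R Y).
    move=> Z ZY; apply: leq_trans (hallS Z (subset_trans ZY YS)) _.
    apply: subset_leq_card; apply/subsetP => j; rewrite !inE.
    case/andP=> jR /existsP[z /andP[zZ zj]]; rewrite jR /=; apply/andP; split.
      by apply/existsP; exists z; rewrite (subsetP ZY).
    by apply/existsP; exists z; rewrite zZ.
  have SYltS : #|S :\: Y| < N.
    rewrite -SN proper_card // properEneq subsetDl andbT.
    apply: contra Y0 => /eqP SY; rewrite -subset0; apply/subsetP => y yY.
    by have := subsetP YS y yY; rewrite -SY inE yY.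
  have [|h2 [inj2 P2]] := IH _ SYltS (S :\: Y) erefl (R :\: nbh R Y).
    move=> Z ZSY; have ZS := subset_trans ZSY (subsetDl _ _).
    have ZY0 : [disjoint Z & Y].
      by rewrite -setI_eq0; apply/eqP/setP => z; rewrite !inE; apply/negP => /andP[/(subsetP ZSY)]; rewrite inE => /andP[/negP].
    have sub : nbh R (Z :|: Y) \subset nbh (R :\: nbh R Y) Z :|: nbh R Y.
      apply/subsetP => j jZY; rewrite inE; case: (boolP (j \in nbh R Y)) => jY.
        by rewrite orbT.
      move: jZY jY; rewrite !inE orbF => /andP[-> /existsP[z]] /=; rewrite inE andbT.
      case/andP=> /orP[zZ|zY] zj.
        by move=> ->; apply/existsP; exists z; rewrite zZ.
      by case/negP; apply/existsP; exists z; rewrite zY.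
    have cZY : #|Z :|: Y| = #|Z| + #|Y|.
      by rewrite cardsU (_ : Z :&: Y = set0) ?cards0 ?subn0 //; apply/eqP; rewrite setI_eq0.
    (* Hall's condition for [Z :|: Y], with the tight contribution of [Y] cancelled. *)
    rewrite -(leq_add2r #|Y|) -cZY -YR; apply: leq_trans (hallS _ _) _.
      by rewrite subUset ZS YS.
    apply: leq_trans (subset_leq_card sub) _.
    by rewrite cardsU leq_subr.
  apply: (glue Y (nbh R Y) h1 h2 YS _ inj1 P1 inj2 P2).
  by apply/subsetP => j; rewrite inE => /andP[].
have [j] : exists j, j \in nbh R [set x].
  by apply/card_gt0P; apply: leq_trans (hallS [set x] _); rewrite ?cards1 // sub1set.
rewrite inE => /andP[jR /existsP[_ /andP[/set1P-> xj]]].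
have SxltS : #|S :\ x| < N by rewrite -SN [in leqRHS](cardsD1 x) xS.
have [|h2 [inj2 P2]] := IH _ SxltS (S :\ x) erefl (R :\ j).
  move=> Y YSx; have YS := subset_trans YSx (subsetDl _ _).
  have [->|Y0] := eqVneq Y set0; first by rewrite cards0.
  have YneS : Y != S.
    by apply: contraTneq YSx => ->; apply/subsetPn; exists x; rewrite // !inE eqxx.
  (* No subset is tight, so the loss of the single point [j] is affordable. *)
  have : #|Y| < #|nbh R Y|.
    rewrite ltn_neqAle hallS // andbT; apply: contra noY => /eqP YR.
    by apply/existsP; exists Y; rewrite YS Y0 YneS -YR eqxx.
  rewrite [in leqRHS](cardsD1 j); case: (j \in _) => // [|/ltnW].
    rewrite ltnS => /leq_trans; apply; apply: subset_leq_card; apply/subsetP => i.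
    by rewrite !inE -andbA.
  move=> /leq_trans; apply; apply: subset_leq_card; apply/subsetP => i.
  by rewrite !inE -andbA.
apply: (glue [set x] [set j] (fun=> j) h2) => //; rewrite ?sub1set //.
- by move=> y z /set1P-> /set1P->.
- by move=> y /set1P->; rewrite set11.
Qed.
End Hall.

(** * The probabilistic placement of a team *)

Section RandomCops.
Variables (R : realType) (T : finType).
Local Open Scope ring_scope.
Local Notation n := #|T|.

(* Markov's inequality for [2 ^ (#|A| - hits)] summed over all [A], with [f]
   a tuple of [m] independent uniform points. *)
Lemma exists_hitting (q m L : nat) (B : {set T} -> {set T}) :
  (0 < n)%N -> (2 * n * L <= q * m)%N -> (4 * n <= 2 ^ L)%N ->
  exists f : 'I_m -> T, forall A : {set T}, (q * #|A| <= #|B A|)%N ->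
    (#|A| <= #|[set j | f j \in B A]|)%N.
Proof.
move=> n0 nL nL4.
have nR0 : (0 : R) < n%:R by rewrite ltr0n.
(* The empty set, for which the claim is trivial, must be left out: its term alone would be 1. *)
pose good A := (A != set0) && (q * #|A| <= #|B A|)%N.
pose w (A : {set T}) (x : T) : R := if x \in B A then 2^-1 else 1.
pose Phi (f : {ffun 'I_m -> T}) : R :=
  \sum_(A | good A) 2 ^+ #|A| * \prod_(j < m) w A (f j).
have w_ge0 A x : 0 <= w A x by rewrite /w; case: ifP => _ //; rewrite invr_ge0.
have sumw A : \sum_x w A x = n%:R - #|B A|%:R / 2.
  have wE x : w A x = 1 - (x \in B A)%:R / 2.
    rewrite /w; case: ifP => _; last by rewrite mul0r subr0.
    by apply/eqP; rewrite eq_sym subr_eq mul1r -div1r -splitr.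
  rewrite (eq_bigr _ (fun x _ => wE x)) sumrB sumr_const -mulr_suml -natr_sum.
  by congr (_ - _%:R / _); rewrite -sum1_card [in RHS]big_mkcond.
have sumPhi : \sum_f Phi f = \sum_(A | good A) 2 ^+ #|A| * (n%:R - #|B A|%:R / 2) ^+ m.
  rewrite exchange_big /=; apply: eq_bigr => A _; rewrite -big_distrr /=.
  have -> : (n%:R - #|B A|%:R / 2) ^+ m = \prod_(j < m) \sum_x w A x.
    by rewrite prodr_const card_ord sumw.
  by rewrite bigA_distr_bigA.
(* With [1 - u <= expR (- u)], the two size conditions bound the power by
   [n ^ m * expR (- L * #|A|)]. Then [expR (-1) <= 1/2] and [4 n <= 2 ^ L] give
   [2 * expR (-1) ^ L <= 1 / (2 n)]. *)
have term A : good A ->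
    2 ^+ #|A| * (n%:R - #|B A|%:R / 2) ^+ m <= n%:R ^+ m * ((2 * n)%:R^-1) ^+ #|A| :> R.
  case/andP=> _ qA.
  have BAn : #|B A|%:R <= n%:R :> R by rewrite ler_nat max_card.
  have e2 : expR (-1) <= 2^-1 :> R.
    by rewrite expRN lef_pV2 ?posrE ?expR_gt0 //; have := expR_ge1Dx (1 : R); lra.
  have h1 : n%:R - #|B A|%:R / 2 <= n%:R * expR (- (#|B A|%:R / (2 * n%:R))) :> R.
    apply: le_trans (_ : n%:R * (1 + (- (#|B A|%:R / (2 * n%:R)))) <= _).
      rewrite le_eqVlt; apply/orP; left; apply/eqP; field.
      by rewrite gt_eqF.
    by rewrite ler_pM2l // expR_ge1Dx.
  have h2 : (n%:R - #|B A|%:R / 2) ^+ m <= n%:R ^+ m * expR (-1) ^+ (L * #|A|) :> R.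
    apply: le_trans (_ : (n%:R * expR (- (#|B A|%:R / (2 * n%:R)))) ^+ m <= _).
      by apply: lerXn2r; rewrite ?nnegrE //; [lra|rewrite mulr_ge0 ?expR_ge0].
    rewrite exprMn ler_pM2l ?exprn_gt0 // -!expRM_natl ler_expR.
    rewrite mulrN mulrN1 lerN2 mulrA ler_pdivlMr ?mulr_gt0 //.
    rewrite -!natrM ler_nat.
    apply: (@leq_trans (q * m * #|A|)).
      by rewrite mulnAC (mulnC L) leq_mul2r nL orbT.
    by rewrite mulnAC mulnC leq_mul2l qA orbT.
  apply: le_trans (ler_wpM2l _ h2) _; first exact: exprn_ge0.
  rewrite mulrCA ler_pM2l ?exprn_gt0 // exprM -exprMn.
  apply: lerXn2r; rewrite ?nnegrE ?invr_ge0 ?mulr_ge0 ?exprn_ge0 ?expR_ge0 //.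
  apply: le_trans (_ : 2 * 2^-1 ^+ L <= _).
    rewrite ler_pM2l //; apply: lerXn2r; rewrite ?nnegrE ?expR_ge0 ?invr_ge0 //.
  rewrite exprVn ler_pdivrMr ?exprn_gt0 // mulrC ler_pdivlMr ?ltr0n ?muln_gt0 //.
  by rewrite -natrX -natrM ler_nat mulnA.
(* A set with too few hits contributes at least 1 to [Phi f]; so it suffices that the mean of [Phi]
   is below 1. *)
have [[f Hf]|nf] := pselect (exists f, Phi f < 1).
  exists f => A qA; rewrite leqNgt; apply/negP => hits.
  have gA : good A by rewrite /good qA andbT -card_gt0 (leq_ltn_trans _ hits).
  move: Hf; rewrite ltNge => /negP; apply.
  rewrite /Phi (bigD1 A) //=; apply: ler_wpDr.
    by apply: sumr_ge0 => C _; rewrite mulr_ge0 ?exprn_ge0 ?prodr_ge0.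
  have -> : \prod_(j < m) w A (f j) = 2^-1 ^+ #|[set j | f j \in B A]|.
    rewrite -sum1_card [in RHS]big_mkcond -prodrXr; apply: eq_bigr => j _.
    by rewrite inE /w; case: ifP.
  by rewrite exprVn ler_pdivlMr ?exprn_gt0 // mul1r ler_eXn2l ?ltr1n // ltnW.
suff : \sum_f Phi f < \sum_(f : {ffun 'I_m -> T}) 1.
  rewrite ltNge ler_sum // => f _; rewrite leNgt; apply/negP => fP.
  by apply: nf; exists f.
have nm0 : 0 < n%:R ^+ m :> R by rewrite exprn_gt0.
rewrite sumPhi sumr_const card_ffun card_ord natrX.
apply: le_lt_trans (ler_sum _ term) _; rewrite -mulr_sumr -[ltRHS]mulr1 ltr_pM2l //.
pose z : R := (2 * n)%:R^-1.
have z0 : 0 < z by rewrite invr_gt0 ltr0n muln_gt0.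
apply: (@le_lt_trans _ _ (\sum_(A : {set T} | A != set0) z ^+ #|A|)).
  rewrite [leLHS]big_mkcond [leRHS]big_mkcond; apply: ler_sum => A _ /=.
  rewrite /good; case: (A != set0) => //=; case: ifP => // _.
  by rewrite exprn_ge0 // ltW.
(* By the binomial expansion; for [z = 1 / (2 n)] this is at most [expR (1/2) - 1 < 1]. *)
have -> : \sum_(A : {set T} | A != set0) z ^+ #|A| = (1 + z) ^+ n - 1.
  have -> : (1 + z) ^+ n = \sum_(A : {set T}) z ^+ #|A|.
    rewrite addrC -prodr_const bigA_distr; apply: eq_bigr => A _.
    by rewrite -big_mkcond prodr_const.
  by rewrite [in RHS](bigD1 set0) //= cards0 expr0 addrAC subrr add0r.
rewrite ltrBlDr; apply: (@le_lt_trans _ _ (expR z ^+ n)).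
  by apply: lerXn2r; rewrite ?nnegrE ?expR_ge0 ?expR_ge1Dx // addr_ge0 // ltW.
rewrite -expRM_natl.
have -> : n%:R * z = 2^-1.
  by rewrite /z natrM invfM mulrCA mulfV ?mulr1 // gt_eqF.
have h : 1 + (- 2^-1) < expR (- 2^-1) :> R by apply: expR_gt1Dx; rewrite oppr_eq0 invr_eq0 pnatr_eq0.
by have := expRxMexpNx_1 (2^-1 : R); have := expR_gt0 (2^-1 : R); nra.
Qed.
End RandomCops.

(** * Balls and geodesics inside the robber's territory, and one team's move *)

Section Balls.
Variables (T : finType) (e : rel T) (U : {set T}).
Hypothesis e_sym : symmetric e.
Local Notation step := (step e).

Definition nbr (A : {set T}) := [set y in U | [exists x in A, step x y]].
Definition ball r A := iter r nbr A.

Lemma nbrP (A : {set T}) y : reflect (y \in U /\ exists2 x, x \in A & step x y) (y \in nbr A).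
Proof.
rewrite inE; apply: (iffP andP) => [[yU /exists_inP[x xA xy]]|[yU [x xA xy]]].
  by split=> //; exists x.
by split=> //; apply/exists_inP; exists x.
Qed.

Lemma ballD r s (A : {set T}) : ball (r + s) A = ball r (ball s A).
Proof. by rewrite /ball iterD. Qed.

Lemma nbrS (A B : {set T}) : A \subset B -> nbr A \subset nbr B.
Proof.
move=> /subsetP AB; apply/subsetP => y /nbrP[yU [x xA xy]].
by apply/nbrP; split=> //; exists x; rewrite ?AB.
Qed.

Lemma ballS r (A B : {set T}) : A \subset B -> ball r A \subset ball r B.
Proof. by move=> AB; elim: r => //= r; apply: nbrS. Qed.

Lemma ball_subU r (A : {set T}) : A \subset U -> ball r A \subset U.
Proof.
by case: r => //= r _; apply/subsetP => y /nbrP[].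
Qed.

Lemma sub_nbr (A : {set T}) : A \subset U -> A \subset nbr A.
Proof.
move=> /subsetP AU; apply/subsetP => x xA.
by apply/nbrP; split; [apply: AU|exists x; rewrite ?step_refl].
Qed.

Lemma ball_leq r s (A : {set T}) : A \subset U -> r <= s -> ball r A \subset ball s A.
Proof.
move=> AU /subnK <-; rewrite ballD; elim: (s - r) => //= d IH.
by apply: subset_trans IH (sub_nbr (ball_subU _ (ball_subU _ AU))).
Qed.

Lemma ballP r (A : {set T}) y : reflect (exists2 x, x \in A & y \in ball r [set x]) (y \in ball r A).
Proof.
apply: (iffP idP) => [|[x xA]]; last first.
  by apply/subsetP/ballS; rewrite sub1set.
elim: r y => [|r IH] y; first by exists y => //; apply: set11.
move=> /nbrP[yU [z /IH[x xA xz] zy]].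
by exists x => //; apply/nbrP; split=> //; exists z.
Qed.

Lemma ball_sym r x y : x \in U -> y \in ball r [set x] -> x \in ball r [set y].
Proof.
move=> xU; elim: r y => [|r IH] y; first by move=> /set1P->; apply: set11.
move=> /nbrP[yU [z /[dup] zr /IH xr zy]].
have zU : z \in U by apply: (subsetP (ball_subU r _)) zr; rewrite sub1set.
rewrite -addn1 ballD; apply/ballP; exists z => //.
by apply/nbrP; split=> //; exists y; rewrite ?set11 // step_sym.
Qed.

Lemma ball_walkto r x y : y \in ball r [set x] -> walkto e r x y.
Proof.
elim: r x => [|r IH] x; first by move=> /set1P->; apply: walkto_refl.
rewrite -addn1 ballD => /ballP[z /nbrP[_ [_ /set1P-> xz]] /IH].
by rewrite addn1; apply: walkto_cons.
Qed.

(** A ball that still grows yields a vertex at distance [D.+1]; tracing back gives a geodesic. With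
    [d] it meets the requirements of [path_guard]. *)
Lemma isometric_path x0 D :
  x0 \in U -> ball D.+1 [set x0] != ball D [set x0] ->
  exists (p : nat -> T) (d : T -> nat),
  [/\ (forall i, i < D.+1 -> step (p i) (p i.+1)),
      (forall i, i <= D.+1 -> p i \in U /\ d (p i) = i),
      (forall x, x \in U -> d x <= D.+1) &
      (forall x y, x \in U -> y \in U -> step x y -> d y <= (d x).+1)].
Proof.
move=> x0U neq.
have x0S : [set x0] \subset U by rewrite sub1set.
pose at_ j x := x \in ball j [set x0] /\ forall i, i < j -> x \notin ball i [set x0].
(* The distance from [x0] inside [U], capped at [D.+1], which also covers vertices of other
   components. *)
pose d x := \sum_(i < D.+1) (x \notin ball i [set x0]).
have dE j x : j <= D.+1 -> at_ j x -> d x = j.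
  move=> jD [xj xi].
  rewrite /d (eq_bigr (fun i : 'I_D.+1 => if i < j then 1 else 0)); last first.
    move=> i _; case: ltnP => [/xi->//|ji].
    by rewrite (subsetP (ball_leq x0S ji) _ xj).
  by rewrite -big_mkcond -(big_ord_widen _ (fun=> 1)) // sum1_card card_ord.
have [x xD] : exists x, at_ D.+1 x.
  have : ~~ (ball D.+1 [set x0] \subset ball D [set x0]).
    apply: contra neq => sub; rewrite eqEsubset sub.
    by rewrite ball_leq.
  move=> /subsetPn[x xD nx]; exists x; split=> // i iD.
  by apply: contra nx; apply/subsetP/ball_leq.
have [p [_ pat pS]] : exists p, [/\ p D.+1 = x, (forall i, i <= D.+1 -> at_ i (p i)) &
    (forall i, i < D.+1 -> step (p i) (p i.+1))].
  elim: (D.+1) x xD => [|j IH] x [xj xi].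
    by exists (fun=> x); split=> // i; rewrite leqn0 => /eqP->.
  have /nbrP[xU [z zj zx]] := xj.
  have [|p [pz pat pS]] := IH z.
    split=> // i ij; apply: contra (xi i.+1 ij) => zi.
    by apply/nbrP; split=> //; exists z.
  exists (fun i => if i == j.+1 then x else p i); rewrite eqxx; split=> // i.
    rewrite leq_eqVlt; case: eqP => [-> _ //|_ /= ij]; exact: pat.
  move=> ij; rewrite [i == _]ltn_eqF // eqSS; case: eqP => [->|/eqP ne].
    by rewrite pz.
  by apply: pS; rewrite ltn_neqAle ne.
exists p, d; split=> // [i iD|y yU|y z yU zU yz].
- split; last by apply: dE => //; apply: pat.
  by apply: (subsetP (ball_subU i x0S)); case: (pat i iD).
- by rewrite -[leqRHS]card_ord -sum1_card; apply: leq_sum => i _; case: (_ \notin _).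
(* Radius 0 costs at most one; a ball of radius [i.+1] missing [z] forces the ball of radius [i] to
   miss its neighbour [y]. *)
rewrite {1}/d big_ord_recl; apply: (leq_add (leq_b1 _)).
rewrite /d big_ord_recr /=; apply: leq_trans (leq_addr _ _).
apply: leq_sum => i _; case: (boolP (z \notin _)) => // zi.
suff -> : y \notin ball i [set x0] by [].
by apply: contra zi => yi; apply/nbrP; split=> //; exists y.
Qed.

(** Hall's theorem assigns distinct cops to the points of [A :\: X], each within distance [r]; the
    other cops wait. *)
Lemma stage m (f : 'I_m -> T) r q (A : {set T}) : A \subset U ->
  (forall Y : {set T}, q * #|Y| <= #|ball r Y| -> #|Y| <= #|[set j | f j \in ball r Y]|) ->
  exists (X : {set T}) (w : 'I_m -> nat -> T),
  [/\ X \subset A, #|ball r X| <= q * #|X|, forall j, w j 0 = f j,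
      forall j s, step (w j s) (w j s.+1) &
      forall x, x \in A -> x \notin X -> exists j, w j r = x].
Proof.
move=> AU hit.
pose small (X : {set T}) := (X \subset A) && (#|ball r X| <= q * #|X|).
have small0 : small set0.
  rewrite /small sub0set cards0 muln0 leqn0 cards_eq0 -subset0.
  by apply/subsetP => y /ballP[x]; rewrite inE.
case: (arg_maxnP (fun X : {set T} => #|X|) small0) => X /andP[XA Xs] Xmax.
have hallX (Y : {set T}) : Y \subset A :\: X ->
    #|Y| <= #|nbh (fun x j => f j \in ball r [set x]) [set: 'I_m] Y|.
  move=> YAX; have [->|Y0] := eqVneq Y set0; first by rewrite cards0.
  have XY : [disjoint X & Y].
    rewrite disjoint_sym; apply/pred0P => z /=; apply/negP => /andP[/(subsetP YAX)].
    by rewrite inE => /andP[/negbTE->].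
  have cXY : #|X :|: Y| = #|X| + #|Y|.
    by apply/eqP; rewrite (leq_card_setU X Y).2.
  (* Otherwise [X :|: Y] would also have a small ball, against the maximality of [X]. *)
  have big : q * #|Y| <= #|ball r Y|.
    apply/ltnW; rewrite ltnNge; apply/negP => Ys.
    have := Xmax (X :|: Y); rewrite cXY /small cXY mulnDr.
    rewrite subUset XA (subset_trans YAX (subsetDl _ _)) /=.
    have sub : ball r (X :|: Y) \subset ball r X :|: ball r Y.
      apply/subsetP => y /ballP[x]; rewrite !inE => /orP[] xX yr; apply/orP.
        by left; apply/ballP; exists x.
      by right; apply/ballP; exists x.
    have -> : #|ball r (X :|: Y)| <= q * #|X| + q * #|Y|.
      apply: leq_trans (subset_leq_card sub) _; rewrite cardsU.
      by apply: leq_trans (leq_subr _ _) (leq_add Xs Ys).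
    move=> /(_ isT); rewrite -[leqRHS]addn0 leq_add2l leqn0 cards_eq0.
    by rewrite (negbTE Y0).
  apply: leq_trans (hit Y big) _; apply: subset_leq_card; apply/subsetP => j.
  rewrite !inE /= => /ballP[x xY xj]; apply/exists_inP; by exists x.
have [j0|m0] := pickP 'I_m; last first.
  exists X, (fun j _ => f j); split=> // [j _|x xA xX]; first exact: step_refl.
  have := hallX [set x]; rewrite sub1set inE xX xA cards1 => /(_ isT).
  by move=> /card_gt0P[j]; have := m0 j.
have [h [hinj hP]] := hall j0 hallX.
have /choice[w wP] j : exists w : nat -> T, [/\ w 0 = f j,
    forall s, step (w s) (w s.+1) &
    forall x, x \in A -> x \notin X -> h x = j -> w r = x].
  have [[x [xA xX hx]]|nx] := pselect (exists x, [/\ x \in A, x \notin X & h x = j]).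
    have [|_ fx] := hP x; first by rewrite inE xX.
    have [|w [w0 wS wr]] := ball_walkto (ball_sym _ fx).
      exact: (subsetP AU).
    exists w; split; rewrite ?w0 ?hx // => y yA yX hy; rewrite wr //.
    by apply: hinj; rewrite ?inE ?xX ?yX // hy.
  exists (fun=> f j); split=> // [s|x xA xX hx]; first exact: step_refl.
  by case: nx; exists x.
exists X, w; split=> // [j|j s|x xA xX]; first by case: (wP j).
  by case: (wP j).
by exists (h x); case: (wP (h x)) => _ _; apply.
Qed.

End Balls.

(** * Catching the robber in a territory of small diameter *)

Section LocalCatch.
Variables (T : finType) (e : rel T) (U : {set T}).
Hypothesis e_sym : symmetric e.
Hypothesis e_conn : forall x y : T, connect e x y.
Local Notation step := (step e).
Local Notation ball := (ball e U).

(** All [t.+1] teams start together and every walk is fixed in advance, from the robber's position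
    [r] alone. *)
Lemma catchable_small_diameter (q t m : nat) (f : nat -> 'I_m -> T) :
  (forall x, x \in U -> ball (2 ^ t).+1 [set x] = ball (2 ^ t) [set x]) ->
  (forall i (Y : {set T}), q * #|Y| <= #|ball (2 ^ i) Y| ->
     #|Y| <= #|[set j | f i j \in ball (2 ^ i) Y]|) ->
  q ^ t.+1 <= t.+1 * m -> catchable e (t.+1 * m) U.
Proof.
move=> closed hit qtm.
(* For [x] in [U] this is its whole component, by [closed]. *)
pose W x := ball (2 ^ t) [set x].
have Wx x : x \in U -> x \in W x.
  move=> xU; have := @ball_leq _ e U 0 (2 ^ t) [set x].
  by rewrite sub1set xU => /(_ isT isT)/subsetP; apply; apply: set11.
have Wcl x y z : x \in U -> y \in W x -> z \in U -> step y z -> z \in W x.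
  by move=> xU yW zU yz; rewrite /W -closed //; apply/nbrP; split=> //; exists y.
have Wball x (B : {set T}) s : x \in U -> B \subset W x -> ball s B \subset W x.
  move=> xU BW; elim: s => //= s IH; apply/subsetP => z /nbrP[zU [y /(subsetP IH) yW yz]].
  exact: Wcl yW zU yz.
apply: (@catchableP _ e ('I_t.+1 * 'I_m)%type); first by rewrite card_prod !card_ord.
move=> c; apply: (@catch_goto _ e e_conn _ U c (fun ij => f ij.1 ij.2)) => {c} r rU.
(* A small component is filled with cops; surplus ones go to the default vertex [r]. *)
have [Wsmall|Wbig] := leqP #|W r| (q ^ t.+1).
    have WI : #|W r| <= #|{: 'I_t.+1 * 'I_m}|.
    by rewrite card_prod !card_ord (leq_trans Wsmall).
  pose c' (ij : 'I_t.+1 * 'I_m) := nth r (enum (W r)) (enum_rank ij).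
  have c'P x : x \in W r -> exists i, c' i = x.
    move=> xW; have lt : index x (enum (W r)) < #|{: 'I_t.+1 * 'I_m}|.
      by apply: leq_trans WI; rewrite cardE index_mem mem_enum.
    exists (enum_val (Ordinal lt)); rewrite /c' enum_valK nth_index //.
    by rewrite mem_enum.
  apply: (@catch_sub _ e _ _ (W r)); [by move=> x y; apply: Wcl| |exact: Wx].
  apply: (@catch_goto _ e e_conn _ _ _ c') => [x /c'P[i <-]|]; last exact: Wx.
  by apply: (catch_now i); apply: step_refl.
have [X1 X1P] : exists X : nat -> {set T} -> {set T}, forall i (A : {set T}), A \subset U ->
   exists w : 'I_m -> nat -> T,
  [/\ X i A \subset A, #|ball (2 ^ i) (X i A)| <= q * #|X i A|, forall j, w j 0 = f i j,
      forall j s, step (w j s) (w j s.+1) &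
      forall x, x \in A -> x \notin X i A -> exists j, w j (2 ^ i) = x].
  have /choice[X XP] (iA : nat * {set T}) : exists X : {set T}, iA.2 \subset U ->
   exists w : 'I_m -> nat -> T,
  [/\ X \subset iA.2, #|ball (2 ^ iA.1) X| <= q * #|X|, forall j, w j 0 = f iA.1 j,
      forall j s, step (w j s) (w j s.+1) &
      forall x, x \in iA.2 -> x \notin X -> exists j, w j (2 ^ iA.1) = x].
    have [AU|nAU] := boolP (iA.2 \subset U); last by exists set0.
    by have [X XP] := stage e_sym AU (hit iA.1); exists X.
  by exists (fun i A => X (i, A)) => i A AU; apply: (XP (i, A)).
(* [A i] is to contain the uncaught robber after [2 ^ i - 1] moves. *)
pose A := fix A i : {set T} := if i is i'.+1 then ball (2 ^ i') (X1 i' (A i')) else [set r].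
pose X i := X1 i (A i).
have XU i : A i \subset U -> X i \subset U.
  by move=> AU; have [w [XA _ _ _ _]] := X1P i _ AU; apply: subset_trans AU.
have AU i : A i \subset U.
  elim: i => [|i IH]; first by rewrite sub1set.
  exact/ball_subU/XU.
have /choice[w wP] i := X1P i _ (AU i).
have cardX i : #|X i| <= q ^ i.
  have XA j : #|X j| <= #|A j|.
    by have [XA _ _ _ _] := wP j; apply: subset_leq_card.
  apply: leq_trans (XA i) _; elim: i => [|i IH]; first by rewrite cards1 expn0.
  have [_ le _ _ _] := wP i; apply: leq_trans le _.
  by rewrite expnS leq_mul2l (leq_trans (XA i) IH) orbT.
have AW i : A i \subset W r.
  elim: i => [|i IH]; first by rewrite sub1set Wx.
  by apply: Wball => //; have [XA _ _ _ _] := wP i; apply: subset_trans IH.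
(* The ball about a point of [X t] would be all of [W r], of size at most
   [q * #|X t| <= q ^ t.+1]. *)
have Xt0 : X t = set0.
  apply/eqP; apply: contraTT Wbig => /set0Pn[x xX]; rewrite -leqNgt.
  have [XA le _ _ _] := wP t.
  rewrite expnS; apply: leq_trans (_ : q * #|X t| <= _); last first.
    by rewrite leq_mul2l cardX orbT.
  apply: leq_trans le; apply: subset_leq_card; apply: subset_trans (_ : W x \subset _).
    have xW : x \in W r by apply/(subsetP (AW t))/(subsetP XA).
    have xU : x \in U by apply/(subsetP (AU t))/(subsetP XA).
    by apply: Wball => //; rewrite sub1set; apply: ball_sym.
  by apply: ballS; rewrite sub1set.
pose g (ij : 'I_t.+1 * 'I_m) := w ij.1 ij.2.
(* Where the robber can be after [s] moves if no cop has landed on him. *)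
pose Rb := fix Rb s : {set T} := if s is s'.+1 then
   [set y in U | [exists x in Rb s', step x y && [forall i, g i s != x]]] else [set r].
have RbD s d : Rb (s + d) \subset ball d (Rb s).
  elim: d => [|d IH]; first by rewrite addn0.
  rewrite addnS; apply/subsetP => y; rewrite inE => /andP[yU /exists_inP[x xR /andP[xy _]]].
  by apply/nbrP; split=> //; exists x => //; apply: (subsetP IH).
have RbX i s : i <= t -> s.+1 = 2 ^ i -> Rb s \subset A i -> Rb (2 ^ i) \subset nbr e U (X i).
  move=> it si /subsetP RA; rewrite -si; apply/subsetP => y.
  rewrite inE => /andP[yU /exists_inP[x xR /andP[xy /forallP ncap]]].
  apply/nbrP; split=> //; exists x => //; apply: contraT => xX.
  have [_ _ _ _ /(_ x (RA x xR) xX)[j jx]] := wP i.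
  by have := ncap (Ordinal (it : i < t.+1), j); rewrite /g /= si jx eqxx.
have Rbi i : i <= t -> Rb (2 ^ i) \subset nbr e U (X i).
  elim: i => [_|i IH it]; first exact: (RbX 0 0).
  have i0 : 0 < 2 ^ i by rewrite expn_gt0.
  (* From [2 ^ i] there are [2 ^ i - 1] moves left until [2 ^ i.+1 - 1]; together with the step out
     of [X i] they make radius [2 ^ i]. *)
  apply: (RbX i.+1 (2 ^ i + (2 ^ i).-1)) => //.
    by rewrite -addnS prednK // addnn -mul2n expnS.
  apply: subset_trans (RbD _ _) _.
  apply: subset_trans (ballS _ _ _ (IH (ltnW it))) _.
  by rewrite -[nbr e U _]/(ball 1 _) -ballD addn1 prednK.
have -> : (fun ij : 'I_t.+1 * 'I_m => f ij.1 ij.2) = g^~ 0.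
  by apply/funext => ij; rewrite /g; case: (wP ij.1).
apply: (catch_along (R := Rb) (N := 2 ^ t)) => [ij s|s x y _ xs yU xy|x|].
- by rewrite /g; case: (wP ij.1).
- have [[i ix]|nx] := pselect (exists i, g i s.+1 = x); first by left; exists i.
  right; rewrite inE yU; apply/exists_inP; exists x; rewrite // xy /=.
  by apply/forallP => i; apply/eqP => ix; apply: nx; exists i.
- by move=> /(subsetP (Rbi t (leqnn t)))/nbrP[_ [y]]; rewrite Xt0 inE.
- exact: set11.
Qed.
End LocalCatch.

(** * Bounds on the cop number in integers *)

Section CopNumber.
Variables (R : realType) (T : finType) (e : rel T).
Hypothesis e_sym : symmetric e.
Hypothesis e_conn : forall x y : T, connect e x y.
Hypothesis T0 : 0 < #|T|.

(** Induction on [#|U|]: long geodesics are guarded and removed one by one, until all balls of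
    radius [2 ^ t] are closed. *)
Lemma catchable_sparse (q t m L : nat) (U : {set T}) :
  2 * #|T| * L <= q * m -> 4 * #|T| <= 2 ^ L -> q ^ t.+1 <= t.+1 * m ->
  catchable e (#|U| %/ 2 ^ t + t.+1 * m) U.
Proof.
move=> TL TL4 qtm; elim/ltn_ind: {U}#|U| {-2}U (erefl #|U|) => N IH U UN.
have [/exists_inP[x0 x0U neq]|] :=
  boolP [exists x in U, ball e U (2 ^ t).+1 [set x] != ball e U (2 ^ t) [set x]].
  have [p [d [pS pU dU dlip]]] := isometric_path x0U neq.
  have pd i (iD : i <= (2 ^ t).+1) := (pU i iD).2.
  pose P := [set p i | i : 'I_(2 ^ t).+2].
  have PU : P \subset U.
    by apply/subsetP => _ /imsetP[i _ ->]; case: (pU i) => //; rewrite -ltnS.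
  have cP : #|P| = (2 ^ t).+2.
    rewrite card_imset ?card_ord // => i j pij; apply: val_inj.
    by rewrite /= -(pd i) -1?(pd j) ?pij // -ltnS.
  have cUP : #|U :\: P| + (2 ^ t).+2 = N by rewrite -UN -cP -(cardsID P U) (setIidPr PU) addnC.
  have lt : #|U :\: P| < N by rewrite -cUP -[ltnLHS]addn0 ltn_add2l.
  apply: catchable_leq (path_guard e_conn e_sym pS pd dU dlip (IH _ lt _ erefl)).
  rewrite -addSn leq_add2r.
  (* Removing more than [2 ^ t] vertices lowers the quotient by at least one, which pays for the
     guard. *)
  apply: (@leq_trans ((#|U :\: P| + 2 ^ t) %/ 2 ^ t)).
    by rewrite divnDr // divnn expn_gt0 addn1.
  by apply: leq_div2r; rewrite UN -cUP leq_add2l ltnW.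
rewrite negb_exists_in => /forall_inP closed.
(* The teams are drawn only for the final [U], since the balls depend on it. *)
have /choice[f fP] i : exists f : 'I_m -> T, forall A : {set T},
    q * #|A| <= #|ball e U (2 ^ i) A| ->
    #|A| <= #|[set j | f j \in ball e U (2 ^ i) A]|.
  exact: (exists_hitting R (ball e U (2 ^ i)) T0 TL TL4).
apply: catchable_leq (leq_addl _ _) _.
apply: (catchable_small_diameter e_sym e_conn) fP qtm => x xU.
by apply/eqP; rewrite -[_ == _]negbK closed.
Qed.

Lemma cop_number_leq k : 0 < k -> catchable e k [set: T] -> cop_number e <= k.
Proof.
move=> k0 kT; have [_ _] := cop_numberP e T0; apply=> //.
exact: catchable_cops_win.
Qed.

Lemma cop_number_leq_card : cop_number e <= #|T|.
Proof.
apply: cop_number_leq => //; apply: (@catchableP _ e T) => // c r rT.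
apply: (@catch_goto _ e e_conn T [set: T] c id) rT => x _.
by apply: (catch_now x); apply: step_refl.
Qed.

(** Here [q = 2 ^ s], [t = s - 2]; [L] ensures [4 n <= 2 ^ L], and [m] rounds [2 n L / q] up. *)
Lemma cop_number_leq_div s : 1 < s -> 2 ^ (s * s) <= #|T| < 2 ^ (s.+1 * s.+1) ->
  cop_number e <= #|T| %/ 2 ^ (s - 2) +
     s.-1 * ((2 * #|T| * (s.+1 * s.+1 + 2)) %/ 2 ^ s).+1.
Proof.
move=> s1 /andP[sT Ts]; set L := s.+1 * s.+1 + 2; set m := (_ %/ _).+1.
have -> : s.-1 = (s - 2).+1 by case: s s1 {sT Ts L m} => // -[|s] //= _; rewrite !subSS subn0.
have TL : 2 * #|T| * L <= 2 ^ s * m.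
  by apply: ltnW; rewrite [ltnRHS]mulnC -ltn_divLR ?expn_gt0.
rewrite -cardsT; apply: cop_number_leq; first by rewrite addnC.
apply: (catchable_sparse TL).
  by rewrite /L addn2 2!expnS mulnA leq_mul2l ltnW.
(* Multiplied by [q], the left side becomes [q ^ s = 2 ^ (s * s) <= n]: this is why [t = s - 2]. *)
rewrite -(@leq_pmul2l (2 ^ s)) ?expn_gt0 // -expnS.
have -> : (s - 2).+2 = s by rewrite -addn2 subnK.
rewrite -expnM; apply: leq_trans sT _.
apply: leq_trans (_ : 2 * #|T| * L <= _).
  by rewrite mulnAC leq_pmull // /L addn2.
by apply: leq_trans TL _; rewrite leq_mul2l leq_pmull ?orbT.
Qed.
End CopNumber.

(** * From integers to real exponents *)

Section Asymptotics.
Variable R : realType.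
Local Open Scope ring_scope.
Implicit Types n k s : nat.

Lemma ln2_gt0 : 0 < ln 2 :> R.
Proof. by rewrite ln_gt0 // ltr1n. Qed.

Lemma ln2_ge_half : 2^-1 <= ln 2 :> R.
Proof.
have := ler_ln (x := expR (2^-1 : R)) (y := 2); rewrite !posrE expR_gt0 expRK ltr0n.
move=> /(_ isT isT) ->.
have := expR_ge1Dx (- 2^-1 : R); have := expRxMexpNx_1 (2^-1 : R).
have := expR_gt0 (2^-1 : R); nra.
Qed.

Lemma log2X k : log2 (2 ^ k)%:R = k%:R :> R.
Proof.
by rewrite /log2 natrX lnXn // -[ln 2 *+ k]mulr_natl mulfK // gt_eqF ?ln2_gt0.
Qed.

Lemma ler_log2 m n : (0 < m)%N -> (m <= n)%N -> log2 m%:R <= log2 n%:R :> R.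
Proof.
move=> m0 mn; rewrite ler_pM2r ?invr_gt0 ?ln2_gt0 //.
by rewrite ler_ln ?posrE ?ltr0n ?ler_nat // (leq_trans m0).
Qed.

Lemma log2_ge k n : (2 ^ k <= n)%N -> k%:R <= log2 n%:R :> R.
Proof. by move=> kn; rewrite -(log2X k) ler_log2 // expn_gt0. Qed.

Lemma log2_le k n : (0 < n)%N -> (n <= 2 ^ k)%N -> log2 n%:R <= k%:R :> R.
Proof. by move=> n0 nk; rewrite -(log2X k) ler_log2. Qed.

(** Compares through [expR y], using [ln 2 >= 1/2]; it turns polynomial factors into powers of
    two. *)
Lemma add1_le_powR (y : R) : 0 <= y -> 1 + y <= 2 `^ (2 * y).
Proof.
move=> y0; apply: le_trans (expR_ge1Dx y) _.
rewrite /powR pnatr_eq0 /= ler_expR.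
by have := ln2_ge_half; nra.
Qed.

Lemma sqrt_log2_bounds n : (0 < n)%N -> exists s : nat,
  (2 ^ (s * s) <= n < 2 ^ (s.+1 * s.+1))%N /\
  s%:R <= Num.sqrt (log2 n%:R) :> R /\ Num.sqrt (log2 n%:R) <= s.+1%:R :> R.
Proof.
move=> n0.
have ex0 : exists s, (2 ^ (s * s) <= n)%N by exists 0%N.
have bnd s : (2 ^ (s * s) <= n)%N -> (s <= n)%N.
  move=> sn; apply: leq_trans sn; apply: leq_trans (ltnW (ltn_expl _ (ltnSn 1))).
  by case: s => // s; rewrite leq_pmulr.
case: (ex_maxnP ex0 bnd) => s sn smax.
have ns : (n < 2 ^ (s.+1 * s.+1))%N.
  by rewrite ltnNge; apply/negP => /smax; rewrite ltnn.
exists s; rewrite sn ns; split=> //; split.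
  rewrite -[leLHS]ger0_norm // -sqrtr_sqr ler_wsqrtr // -natrX.
  exact: log2_ge.
rewrite -[leRHS]ger0_norm // -sqrtr_sqr ler_wsqrtr // -natrX.
exact/log2_le/ltnW.
Qed.

Lemma ler_divn m d : (0 < d)%N -> (m %/ d)%:R <= m%:R / d%:R :> R.
Proof. by move=> d0; rewrite ler_pdivlMr ?ltr0n // -natrM ler_nat leq_trunc_div. Qed.

Lemma cop_number_leq_powR (T : finType) (e : rel T) :
  simple_graph e -> connected_graph e ->
  (cop_number e)%:R <= #|T|%:R *
    2 `^ (17 * Num.sqrt (Num.sqrt (log2 #|T|%:R)) - Num.sqrt (log2 #|T|%:R)) :> R.
Proof.
move=> [e_sym _] [T0 e_conn]; set x := Num.sqrt (log2 _); set y := Num.sqrt x.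
have x0 : 0 <= x by apply: sqrtr_ge0.
have y0 : 0 <= y by apply: sqrtr_ge0.
have yx : x = y ^+ 2 by rewrite sqr_sqrtr.
have n0 : (0 : R) < #|T|%:R by rewrite ltr0n.
have [s [sn [sx xs]]] := sqrt_log2_bounds T0.
rewrite -/x in sx xs.
(* Here [x <= 2], so the exponent [17 y - y ^ 2] is nonnegative and [n] cops suffice. *)
have [s1|s1] := leqP s 1.
  apply: le_trans (_ : #|T|%:R <= _).
    by rewrite ler_nat; apply: cop_number_leq_card.
  apply: ler_peMr; first exact: ltW.
  rewrite -[leLHS](powRr0 (2 : R)) ler_powR ?ler1n //.
  have : s.+1%:R <= 2 :> R by rewrite ler_nat.
  nra.
have y1 : 1 <= y.
  have : 2 <= s%:R :> R by rewrite ler_nat.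
  nra.
have cs := cop_number_leq_div R e_sym e_conn T0 s1 sn.
have q0 : (0 : R) < 2 ^+ s by rewrite exprn_gt0.
set N : R := #|T|%:R in n0 *; pose a := N / 2 ^+ s.
(* Lets [a] absorb the rounding of [m]. *)
have a1 : 1 <= a.
  rewrite ler_pdivlMr // mul1r /N -natrX ler_nat; case/andP: sn => + _.
  by apply: leq_trans; rewrite leq_exp2l // leq_pmulr // ltnW.
have c1 : (cop_number e)%:R <= a * (16 * (1 + s%:R) ^+ 3).
  apply: le_trans (_ : 4 * a + s%:R * (2 * a * ((1 + s%:R) ^+ 2 + 2) + 1) <= _).
    move: cs; rewrite -(ler_nat R) => /le_trans; apply.
    rewrite natrD natrM; apply: lerD; last first.
      apply: ler_pM => //; first by rewrite ler_nat leq_pred.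
      rewrite -natr1 lerD2r; apply: le_trans (ler_divn _ _) _; first by rewrite expn_gt0.
      rewrite natrM natrD !natrM -(natr1 s) natrX /a /N le_eqVlt; apply/orP; left.
      by apply/eqP; field; rewrite gt_eqF.
    apply: le_trans (ler_divn _ _) _; first by rewrite expn_gt0.
    rewrite le_eqVlt; apply/orP; left; apply/eqP.
    have -> : a = N / (4 * 2 ^+ (s - 2)).
      by rewrite /a -{1}(subnK s1) addnC exprD; congr (_ / (_ * _)); ring.
    by rewrite natrX; field; rewrite gt_eqF // exprn_gt0.
  move: (s%:R : R) (ler0n R s) => u u0.
  have : u * 1 <= u * a by apply: ler_wpM2l.
  have : a * (4 + u * (2 * ((1 + u) ^+ 2 + 2) + 1)) <= a * (16 * (1 + u) ^+ 3).
    by apply: ler_wpM2l; nra.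
  lra.
apply: le_trans c1 _; rewrite /a -mulrA ler_pM2l //.
pose b : R := 2 `^ (2 * y).
have b0 : 0 <= b by apply: powR_ge0.
(* Since [s <= x = y ^ 2], [1 + s <= (1 + y) ^ 2]. *)
have sb : 1 + s%:R <= b ^+ 2.
  by have := add1_le_powR y0; rewrite -/b; nra.
(* [17 = 12 + 5]: [16 (1 + s) ^ 3 <= 2 ^ (12 y + 4)], and [x <= s + 1]. *)
apply: (@le_trans _ _ (2 `^ (2 * y * 6%:R + 4%:R + - s%:R))); last first.
  by apply: ler_powR; [rewrite ler1n|move: xs; rewrite -natr1; lra].
have two0 : (2 : R) != 0 by rewrite pnatr_eq0.
rewrite powRD ?two0 ?implybT // powRD ?two0 ?implybT // powRN powRrM !powR_mulrn //.
rewrite mulrC ler_pM2r ?invr_gt0 // -/b mulrC.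
have -> : 2 ^+ 4 = 16 :> R by ring.
rewrite ler_pM2r // (exprM b 2 3); apply: lerXn2r; rewrite ?nnegrE //.
  by rewrite addr_ge0.
by rewrite exprn_ge0.
Qed.
End Asymptotics.

(* The error function and its limit *)
From mathcomp Require Import classical_sets topology normedtype.
Import numFieldNormedType.Exports.
Local Open Scope classical_set_scope.
Local Open Scope ring_scope.

Theorem theorem1p1 (R : realType) :
  exists eps : nat -> R,
    (eps n @[n --> \oo] --> (0 : R)) /\
    forall (n : nat) (T : finType) (e : rel T),
      simple_graph e -> connected_graph e -> #|T| = n ->
      (cop_number e)%:R
        <= n%:R * 2 `^ (- ((1 + eps n) * Num.sqrt (log2 n%:R))) :> R.
Proof.
(* With [x = y ^ 2] the exponent [17 y - x] equals [- (1 - 17 / y) x]. *)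
exists (fun n => - (17 / Num.sqrt (Num.sqrt (log2 n%:R)))); split.
  rewrite -oppr0; apply: cvgN; apply/cvgrPdist_le => eps eps0.
  (* [k] exceeds [17 / eps], and [n >= 2 ^ (k ^ 4)] makes the fourth root of the logarithm at least
     [k]. *)
  pose k := (Num.truncn (17 / eps)).+1.
  exists (2 ^ (k ^ 4))%N => // n /= kn; rewrite sub0r normrN.
  have kx : k%:R <= Num.sqrt (Num.sqrt (log2 n%:R)) :> R.
    have -> : k%:R = Num.sqrt (Num.sqrt (k ^ 4)%:R) :> R.
      by rewrite natrX (exprM _ 2 2) sqrtr_sqr ger0_norm ?exprn_ge0 // sqrtr_sqr ger0_norm.
    by rewrite ler_wsqrtr // ler_wsqrtr // log2_ge.
  have k0 : (0 : R) < k%:R by rewrite ltr0n.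
  have x0 := lt_le_trans k0 kx.
  rewrite ger0_norm; last by rewrite divr_ge0 // ltW.
  rewrite ler_pdivrMr // mulrC -ler_pdivrMr //.
  by apply: le_trans kx; apply/ltW/truncnS_gt.
move=> n T e sg cg <-; apply: le_trans (cop_number_leq_powR R sg cg) _.
rewrite ler_pM2l; last by rewrite ltr0n; case: cg.
rewrite le_eqVlt; apply/orP; left; apply/eqP; congr (_ `^ _) => /=.
set x := Num.sqrt (log2 _); have x0 : 0 <= x by apply: sqrtr_ge0.
rewrite [in RHS]mulrDl mul1r mulNr opprB; congr (_ - _).
(* For [n = 1] the division by zero is harmless, as both exponents vanish. *)
have [->|xn0] := eqVneq x 0; first by rewrite sqrtr0 !mulr0.
have y0 : Num.sqrt x != 0 by rewrite sqrtr_eq0 -ltNge lt_neqAle eq_sym xn0.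
by rewrite -[X in _ = _ * X](sqr_sqrtr x0) expr2 mulrA mulfVK.
Qed.
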